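(* The constraint $$\bm{a}_1^-=\bm{0},\qquad b_1^-=0$$ is a valid tightening constraint of the mixed-integer linear problem $MILP1(Q)$: adding it to $MILP1(Q)$ does not change the set of CPWL solutions $f$ represented by the feasible solutions.
   Context: Let $S=(\bm{x}_i,z_i)_{i=1,\dots,N}$ be a set of $N\ge d+1$ points of $\mathbb{R}^{d+1}$ with $(\bm{x}_i)$ in general position in $\mathbb{R}^d$ (any $d+1$ of them affinely independent), $D$ the convex hull of $\{\bm{x}_1,\dots,\bm{x}_N\}$, $\varepsilon\ge 0$, and $P^+,P^-\ge 1$ integers. $MILP1(Q)$ is the problem of minimizing a linear objective $Q$ over continuous variables $\bm{a}_j^c\in\mathbb{R}^d$, $b_j^c\in\mathbb{R}$ ($j\in\{1,\dots,P^c\}$, $c\in\{+,-\}$), $f(\bm{x}_i),f^+(\bm{x}_i),f^-(\bm{x}_i),e_i\in\mathbb{R}$ and binary variables $\delta_{i,j}^c\in\{0,1\}$, subject to, for all $i\in\{1,\dots,N\}$, $c\in\{+,-\}$, $j\in\{1,\dots,P^c\}$: $f(\bm{x}_i)=f^+(\bm{x}_i)-f^-(\bm{x}_i)$; $0\le f^c(\bm{x}_i)-{\bm{a}_j^c}^T\bm{x}_i-b_j^c$; $f^c(\bm{x}_i)-{\bm{a}_j^c}^T\bm{x}_i-b_j^c\le M_i^c(1-\delta_{i,j}^c)$; $\sum_{j=1}^{P^c}\delta_{i,j}^c\ge 1$; $-e_i\le f(\bm{x}_i)-z_i\le e_i$; $0\le e_i\le\varepsilon$. Here the big-M parameters $M_i^c$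 are assumed large enough that the constraint containing them is not restrictive when $\delta_{i,j}^c=0$. A feasible solution represents the CPWL function (CPWL solution) $f=f^+-f^-$ on $D$ with $f^c(\bm{x})=\max_{j\in\{1,\dots,P^c\}}f_j^c(\bm{x})$, $f_j^c(\bm{x})={\bm{a}_j^c}^T\bm{x}+b_j^c$. This is a difference-of-convex (DC) representation of $f$ as a difference of two maxima of affine functions; it is not unique. *)

(* Defs.v *)
From HB Require Import structures.
From mathcomp Require Import all_boot all_order all_algebra.
From mathcomp Require Import classical_sets reals constructive_ereal convex.

Set Implicit Arguments.
Unset Strict Implicit.
Unset Printing Implicit Defensive.

Import Order.TTheory GRing.Theory Num.Theory.

Local Open Scope classical_set_scope.
Local Open Scope ring_scope.

Section Points.
Context {R : realType} {d : nat}.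
Implicit Types N : nat.

Definition affinely_independent k (y : 'I_k -> 'cV[R]_d) : Prop :=
  forall w : 'I_k -> R,
    \sum_i w i = 0 -> \sum_i w i *: y i = 0 -> forall i, w i = 0.

Definition general_position N (x : 'I_N -> 'cV[R]_d) : Prop :=
  forall s : 'I_d.+1 -> 'I_N, injective s -> affinely_independent (x \o s).

Definition convex_hull (A : set 'cV[R]_d) : set 'cV[R]_d :=
  smallest [set C : set 'cV[R]_d | @convex_set R 'cV[R]_d C] A.

End Points.

(* An optimization problem over the decision space [V].  Binary decision
   variables are real coordinates constrained to take the values 0 and 1, so
   that a linear objective is a linear form on [V]. *)
Record program (R : realType) (V : lmodType R) := Program {
  objective : {scalar V};
  feasible : set V }.

Definition add_constraint (R : realType) (V : lmodType R) (pb : program V)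
    (C : set V) : program V :=
  Program (objective pb) (feasible pb `&` C).

Section MILP1.
Context {R : realType} (d N : nat).

(* The variables attached to one sign c, with P >= 1 affine pieces:
   the slopes a_j (rows), the intercepts b_j, the values f^c(x_i), and the
   binary variables delta_(i, j). *)
Definition dc_part (p : nat) : lmodType R :=
  ('M[R]_(p, d) * 'cV[R]_p * 'cV[R]_N * 'M[R]_(N, p))%type.

Definition slope p (v : dc_part p) (j : 'I_p) : 'rV[R]_d := row j v.1.1.1.
Definition intercept p (v : dc_part p) (j : 'I_p) : R := v.1.1.2 j 0.
Definition value p (v : dc_part p) (i : 'I_N) : R := v.1.2 i 0.
Definition delta p (v : dc_part p) (i : 'I_N) (j : 'I_p) : R := v.2 i j.

Definition piece p (v : dc_part p) (j : 'I_p) (y : 'cV[R]_d) : R :=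
  (slope v j *m y) 0 0 + intercept v j.

(* The numbers of pieces are the successors of the parameters [p] and [q]
   below, so that they are at least 1; piece number 1 has index [ord0]. *)
Definition max_piece p (v : dc_part p.+1) (y : 'cV[R]_d) : R :=
  \big[Num.max/piece v ord0 y]_(j < p.+1) piece v j y.

(* A big-M parameter is an extended real: with the value +oo, and the
   convention +oo * 0 = 0, the second constraint reads "<= 0" if delta = 1 and
   is void if delta = 0.  As the slopes and intercepts are unbounded, no finite
   value makes it void for every choice of the other variables. *)
Definition dc_part_constraints (x : 'I_N -> 'cV[R]_d) (M : 'I_N -> \bar R)
    p (v : dc_part p) : Prop :=
  [/\ forall i j, 0 <= value v i - piece v j (x i),
      forall i j, ((value v i - piece v j (x i))%:E
                    <= M i * (1 - delta v i j)%:E)%E,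
      forall i, 1 <= \sum_j delta v i j &
      forall i j, delta v i j = 0 \/ delta v i j = 1].

(* All the variables: the parts for the signs + and -, then the f(x_i), then
   the e_i. *)
Definition variables (p q : nat) : lmodType R :=
  (dc_part p * dc_part q * 'cV[R]_N * 'cV[R]_N)%type.

Definition pos_part p q (v : variables p q) : dc_part p := v.1.1.1.
Definition neg_part p q (v : variables p q) : dc_part q := v.1.1.2.
Definition fvalue p q (v : variables p q) (i : 'I_N) : R := v.1.2 i 0.
Definition error p q (v : variables p q) (i : 'I_N) : R := v.2 i 0.

Definition MILP1_constraints (x : 'I_N -> 'cV[R]_d) (z : 'I_N -> R) (eps : R)
    (Mpos Mneg : 'I_N -> \bar R) p q (v : variables p q) : Prop :=
  [/\ forall i, fvalue v i = value (pos_part v) i - value (neg_part v) i,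
      dc_part_constraints x Mpos (pos_part v),
      dc_part_constraints x Mneg (neg_part v),
      forall i, - error v i <= fvalue v i - z i <= error v i &
      forall i, 0 <= error v i <= eps].

Definition MILP1 (x : 'I_N -> 'cV[R]_d) (z : 'I_N -> R) (eps : R)
    (Mpos Mneg : 'I_N -> \bar R) p q (Q : {scalar variables p q}) :
    program (variables p q) :=
  Program Q [set v | MILP1_constraints x z eps Mpos Mneg v].

Definition cpwl p q (D : set 'cV[R]_d) (v : variables p.+1 q.+1) : D -> R :=
  fun y => max_piece (pos_part v) (val y) - max_piece (neg_part v) (val y).

Definition cpwl_solutions p q (D : set 'cV[R]_d)
    (pb : program (variables p.+1 q.+1)) : set (D -> R) :=
  [set cpwl v | v in feasible pb].

Definition valid_tightening p q (D : set 'cV[R]_d)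
    (pb : program (variables p.+1 q.+1)) (C : set (variables p.+1 q.+1)) :
    Prop :=
  @cpwl_solutions p q D (add_constraint pb C) = @cpwl_solutions p q D pb.

End MILP1.

(* Main.v *)
Require Import Defs.
From mathcomp Require Import all_boot all_order all_algebra.
From mathcomp Require Import boolp classical_sets reals constructive_ereal.

Set Implicit Arguments.
Unset Strict Implicit.
Unset Printing Implicit Defensive.

Import Order.TTheory GRing.Theory Num.Theory.
Local Open Scope classical_set_scope.
Local Open Scope ring_scope.

(** A DC representation is not unique: subtracting the same affine function
    from every piece of f^+ and of f^- changes neither f nor any of the slacks
    f^c(x_i) - f_j^c(x_i), the binary variables being kept. Subtracting f_1^-
    makes the first piece of f^- vanish. *)

Section Translation.
Context {R : realType} {d N : nat}.
Variables (x : 'I_N -> 'cV[R]_d) (a : 'rV[R]_d) (b : R).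

Definition affine (y : 'cV[R]_d) : R := (a *m y) 0 0 + b.

(** The values f^c(x_i) are decision variables of their own, not computed from the pieces, so they
    have to be shifted along with the slopes and intercepts. *)
Definition sub_affine p (v : dc_part d N p) : dc_part d N p :=
  (v.1.1.1 - \matrix_(j < p) a, v.1.1.2 - const_mx b,
   v.1.2 - \col_i affine (x i), v.2).

Lemma slope_sub_affine p (v : dc_part d N p) j :
  slope (sub_affine v) j = slope v j - a.
Proof. by rewrite /slope /= linearB /= rowK. Qed.

Lemma intercept_sub_affine p (v : dc_part d N p) j :
  intercept (sub_affine v) j = intercept v j - b.
Proof. by rewrite /intercept !mxE. Qed.

Lemma value_sub_affine p (v : dc_part d N p) i :
  value (sub_affine v) i = value v i - affine (x i).
Proof. by rewrite /value !mxE. Qed.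

Lemma piece_sub_affine p (v : dc_part d N p) j y :
  piece (sub_affine v) j y = piece v j y - affine y.
Proof.
rewrite /piece slope_sub_affine intercept_sub_affine mulmxBl !mxE /affine.
by rewrite mxE opprD addrACA.
Qed.

Lemma max_piece_sub_affine p (v : dc_part d N p.+1) y :
  max_piece (sub_affine v) y = max_piece v y - affine y.
Proof.
rewrite /max_piece piece_sub_affine.
(* Translation commutes with [Num.max]. The seed of the iterated maximum is the first piece, not a
   neutral element, so it is translated as well. *)
rewrite (big_morph (fun s => s - affine y) (fun s t => addr_maxl s t _) erefl).
by apply: eq_bigr => j _; rewrite piece_sub_affine.
Qed.

(** Values and pieces enter the constraints only through the slacks, which are invariant; hence the
    same [M] serves. *)
Lemma dc_part_constraints_sub_affine M p (v : dc_part d N p) :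
  dc_part_constraints x M v -> dc_part_constraints x M (sub_affine v).
Proof.
have slackE i j : value (sub_affine v) i - piece (sub_affine v) j (x i) =
    value v i - piece v j (x i).
  by rewrite value_sub_affine piece_sub_affine opprB addrA subrK.
by case=> ge0 leM sum1 bin; split=> // i j; rewrite slackE.
Qed.

(** The f(x_i) and e_i stay fixed, since the shifts of the two parts cancel in f^+ - f^-. *)
Definition sub_affine_variables p q (v : variables d N p q) :
    variables d N p q :=
  (sub_affine (pos_part v), sub_affine (neg_part v), v.1.2, v.2).

Lemma MILP1_constraints_sub_affine z eps Mpos Mneg p q
    (v : variables d N p q) :
  MILP1_constraints x z eps Mpos Mneg v ->
  MILP1_constraints x z eps Mpos Mneg (sub_affine_variables v).
Proof.
case=> fE cpos cneg err err_eps.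
split=> //; try exact: dc_part_constraints_sub_affine.
by move=> i; rewrite !value_sub_affine opprB addrA subrK; exact: fE.
Qed.

Lemma cpwl_sub_affine p q D (v : variables d N p.+1 q.+1) :
  @cpwl R d N p q D (sub_affine_variables v) = @cpwl R d N p q D v.
Proof.
apply/funext => y.
by rewrite /cpwl !max_piece_sub_affine opprB addrA subrK.
Qed.

End Translation.

Theorem theorem2 (R : realType) (d N p q : nat)
    (x : 'I_N -> 'cV[R]_d) (z : 'I_N -> R) (eps : R)
    (Mpos Mneg : 'I_N -> \bar R) (Q : {scalar variables d N p.+1 q.+1}) :
  (d.+1 <= N)%N ->
  general_position x ->
  0 <= eps ->
  valid_tightening (convex_hull (range x))
    (MILP1 x z eps Mpos Mneg Q)
    [set v | slope (neg_part v) ord0 = 0 /\ intercept (neg_part v) ord0 = 0].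
Proof.
(* One inclusion just forgets the added constraint. *)
move=> _ _ _; apply/seteqP; split=> f [v].
  by case=> feas_v _ <-; exists v.
move=> feas_v <-.
(* For the other inclusion, the function to subtract is f_1^- of the given solution itself. *)
pose a := slope (neg_part v) ord0; pose b := intercept (neg_part v) ord0.
exists (sub_affine_variables x a b v); last exact: cpwl_sub_affine.
split; first exact: MILP1_constraints_sub_affine.
by split; rewrite /= ?slope_sub_affine ?intercept_sub_affine subrr.
Qed.
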